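(* Let $d\ge 1$ and $k\ge 1$ be integers, let $a>0$, and let $V:\mathbb{R}^d\to\mathbb{R}$ be given by $V(q)=a|q|^{2k}$. Then for every $h>0$ the system $$\ddot q+V'(q)=0,\qquad \tfrac12|\dot q|^2+V(q)=h$$ has at least one non-constant periodic solution, i.e. there exist $T>0$ and a non-constant $T$-periodic function $q\in C^2(\mathbb{R},\mathbb{R}^d)$ satisfying both equations for all $t\in\mathbb{R}$.
   Context: $V'(q)$ denotes the gradient of $V$ at $q$ and $|\cdot|$ the Euclidean norm on $\mathbb{R}^d$. Dots over $q$ denote derivatives with respect to $t$. *)

(* Defs.v *)
From mathcomp Require Import all_boot all_order all_algebra.
From mathcomp Require Import all_classical all_reals all_analysis.
Set Implicit Arguments.
Unset Strict Implicit.
Unset Printing Implicit Defensive.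
Import Order.TTheory GRing.Theory Num.Theory.
Import numFieldNormedType.Exports.
Local Open Scope ring_scope.
Local Open Scope classical_set_scope.

(* The library's norm `|x| on 'rV[R]_d is the sup norm, hence a separate
   definition of the Euclidean one. *)
Definition enorm {R : realType} {d : nat} (x : 'rV[R]_d) : R :=
  Num.sqrt (\sum_(i < d) x 0 i ^+ 2).

Definition gradient {R : realType} {d : nat} (V : 'rV[R]_d -> R)
    (q : 'rV[R]_d) : 'rV[R]_d :=
  \row_(i < d) 'D_(delta_mx 0 i) V q.

(* Derivability is required explicitly because f^`() is a total operator, with
   an unspecified value where f is not derivable. *)
Definition C2 {R : realType} {d : nat} (f : R -> 'rV[R]_d) : Prop :=
  [/\ forall t, derivable f t 1,
      forall t, derivable f^`() t 1 &
      continuous f^`(2)].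

(* Main.v *)
Require Import Defs.
From mathcomp Require Import all_boot all_order all_algebra.
From mathcomp Require Import all_classical all_reals all_analysis.
From mathcomp Require Import ring lra.
Import Order.TTheory GRing.Theory Num.Theory.
Import numFieldNormedType.Exports.
Local Open Scope ring_scope.
Local Open Scope classical_set_scope.

(* A solution moving along a line: q = x(t) e with e a unit vector and
   x'' = - 2 k a x^(2k-1). With A such that a A^(2k) = h, substitute
   x = A sin phi. Since 1 - s^(2k) = (1 - s^2) P(s) with P = \sum_(i<k) s^(2i)
   >= 1, conservation of energy becomes phi' = g(phi) with
   g = sqrt (2 h P(sin phi)) / A smooth, positive and 2 pi-periodic: the
   turning points are no longer singular. Separating variables, phi is the
   inverse of a primitive of 1 / g, and advances by 2 pi in a fixed time T. *)

(** * Primitives and autonomous equations on the line *)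

Lemma continuous_primitive (R : realType) (f : R -> R) : continuous f ->
  exists F : R -> R, forall x : R, is_derive x (1 : R) F (f x).
Proof.
move=> cf; pose mu := @lebesgue_measure R.
have intf (u v : R) : mu.-integrable `[u, v] (EFin \o f).
  apply: continuous_compact_integrable; first exact: segment_compact.
  exact: continuous_subspaceT.
(* The oriented integral from [0] to [x], so that one function serves on the whole line. *)
pose F x : R := if 0 <= x then \int[mu]_(t in `]0, x]) f t
  else - \int[mu]_(t in `]x, 0]) f t.
(* The FTC is stated for a base point strictly to the left of [x]. *)
have FE (b x : R) : b <= 0 -> b <= x ->
    F x = \int[mu]_(t in `[b, x]) f t - \int[mu]_(t in `[b, 0]) f t.
  move=> b0 bx; rewrite /F; case: ifPn => [x0|].
    by rewrite -(@Rintegral_itvB _ _ (BLeft b) (BRight x)).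
  rewrite -ltNge => /ltW x0.
  by rewrite -(@Rintegral_itvB _ _ (BLeft b) (BRight 0)) ?opprB.
exists F => x.
pose b := Num.min x 0 - 1.
have bx : b < x by rewrite /b ltrBlDr gt_min ltrDl ltr01.
have b0 : b < 0 by rewrite /b subr_lt0 gt_min ltr01 orbT.
have xx1 : x < x + 1 by rewrite ltrDl.
have [dI IE] := continuous_FTC1_closed xx1 (intf b _) bx (cf x).
apply: (@near_eq_is_derive _ _ _
  (fun y => \int[mu]_(t in `[b, y]) f t - \int[mu]_(t in `[b, 0]) f t)).
  near=> y; rewrite (FE b)// ?(ltW b0)// ltW//.
  by near: y; exact: lt_nbhsr.
rewrite -[f x]subr0; apply: is_deriveB.
by apply: DeriveDef; rewrite // -derive1E.
Unshelve. all: by end_near. Qed.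

Lemma is_derive_scalel (R : numFieldType) (V : normedModType R) (v : V)
    (f : R -> R) (t df : R) :
  is_derive t (1 : R) f df ->
  is_derive t (1 : R) (fun s => f s *: v) (df *: v).
Proof.
move=> [/cvg_ex[l fl] fE].
have {}fl : h^-1 *: ((f \o shift t) (h *: 1) - f t) @[h --> 0^'] --> df.
  by rewrite -fE /derive (cvg_lim _ fl).
have H : h^-1 *: (((fun s => f s *: v) \o shift t) (h *: 1) - f t *: v)
    @[h --> 0^'] --> df *: v.
  under eq_fun do rewrite /= -scalerBl scalerA.
  exact: cvgZr_tmp.
split; first by apply/cvg_ex; exists (df *: v).
exact: cvg_lim.
Qed.

Lemma gt0_is_derive_homo (R : realType) (f df : R -> R) :
  (forall x : R, is_derive x (1 : R) f (df x)) -> (forall x, 0 < df x) ->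
  {homo f : x y / x < y}.
Proof.
move=> fE df0 x y xy.
have [|c _ fc] := MVT xy (fun z _ => fE z).
  apply: continuous_subspaceT => z.
  by apply/differentiable_continuous/derivable1_diffP; case: (fE z).
by rewrite -subr_gt0 fc mulr_gt0// subr_gt0.
Qed.

(* For a primitive [F] of [1 / g], the constant [F (u + p) - F u] is the period
   [T]; this translation rule also makes [F] surjective. *)
Lemma periodic_autonomous_ode (R : realType) (g : R -> R) (p : R) :
  continuous g -> (forall u, 0 < g u) -> 0 < p -> periodic g p ->
  exists (phi : R -> R) (T : R),
    [/\ 0 < T, forall t : R, is_derive t (1 : R) phi (g (phi t)) &
        forall t, phi (t + T) = phi t + p].
Proof.
move=> cg g0 p0 gp.
have [|F FE] := @continuous_primitive R (fun u => (g u)^-1).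
  by move=> u; apply: continuousV; [rewrite gt_eqF|exact: cg].
have Fcont : continuous F.
  by move=> z; apply/differentiable_continuous/derivable1_diffP; case: (FE z).
have Flt : {homo F : x y / x < y}.
  by apply: gt0_is_derive_homo FE _ => u; rewrite invr_gt0.
have Fi : injective F by exact: inc_inj (le_mono Flt).
have [T TE] : {T | T = F p - F 0} by exists (F p - F 0).
have T0 : 0 < T by rewrite TE subr_gt0 Flt.
have FT u : F (u + p) = F u + T.
  suff : F (u + p) - F u = F (0 + p) - F 0 by rewrite add0r -TE; lra.
  (* The derivative is [(g (x + p))^-1 - (g x)^-1], which vanishes by periodicity. *)
  apply: (@is_derive_0_is_cst _ (fun u => F (u + p) - F u)) => x.
  rewrite -(subrr (g x)^-1); apply: is_deriveB.
  rewrite -[X in is_derive _ _ _ X]mulr1.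
  apply: (@is_derive1_comp _ F (shift p)); last exact: is_derive_shift.
  by have := FE (x + p); rewrite gp.
have FTn n : F (p *+ n) = F 0 + T *+ n.
  elim: n => [|n IH]; first by rewrite !mulr0n addr0.
  by rewrite !mulrSr FT IH -addrA.
have FTNn n : F (- (p *+ n)) = F 0 - T *+ n.
  elim: n => [|n IH]; first by rewrite !mulr0n oppr0 addr0.
  have := FT (- (p *+ n.+1)).
  rewrite mulrSr opprD subrK IH -opprD -mulrSr => E.
  by rewrite [T *+ n.+1]mulrSr; lra.
have Fsurj t : exists u, F u = t.
  (* By the Archimedean property, [n] periods carry [F] past [t] on both sides; the intermediate
     value theorem then applies. *)
  pose n := Num.bound `|(t - F 0) / T|.
  have /andP[lt1 lt2] : - (T *+ n) < t - F 0 < T *+ n.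
    rewrite -ltr_norml -(mulr_natl T n) -ltr_pdivrMr//.
    by rewrite -[X in _ / X](gtr0_norm T0) -normf_div archi_boundP.
  have [|||u _ <-] := @IVT _ F (- (p *+ n)) (p *+ n) t; last by exists u.
  - by rewrite lerNl (le_trans (y := 0))// ?oppr_le0 mulrn_wge0// ltW.
  - exact: continuous_subspaceT.
  - rewrite FTn FTNn ge_min le_max; apply/andP; split; apply/orP;
      [left|right]; lra.
have [phi phiK] := choice Fsurj.
have Fphi : cancel F phi by move=> u; apply: Fi; rewrite phiK.
exists phi, T; split => // t.
- have := @is_derive_inverse _ F phi (g (phi t))^-1 (phi t).
  rewrite phiK invrK; apply.
  + by near=> u; exact: Fphi.
  + by near=> u; exact: Fcont.
  + by rewrite invr_eq0 gt_eqF.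
- by apply: Fi; rewrite phiK FT phiK.
Unshelve. all: by end_near. Qed.

(** * The one-dimensional oscillator *)

Lemma exists_rootn (R : realType) (n : nat) (x : R) : (0 < n)%N -> 0 < x ->
  exists2 y : R, 0 < y & y ^+ n = x.
Proof.
move=> n0 x0; exists (x `^ n%:R^-1); first exact: powR_gt0.
rewrite -powR_mulrn ?powR_ge0// -powRrM mulVf ?powRr1 ?(ltW x0)//.
by rewrite pnatr_eq0 -lt0n.
Qed.

(** The constant term is [1] and the other terms are even powers. This keeps the radicand of [g]
    positive. *)
Lemma geometric_poly_ge1 (R : realDomainType) (n : nat) (s : R) :
  1 <= (\sum_(i < n.+1) 'X^2 ^+ i).[s].
Proof.
rewrite big_ord_recl hornerD expr0 hornerC lerDl horner_sum sumr_ge0// => i _.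
by rewrite !hornerE exprn_ge0 ?sqr_ge0.
Qed.

Lemma geometric_poly_horner (R : comNzRingType) (n : nat) (s : R) :
  (s ^+ 2 - 1) * (\sum_(i < n) 'X^2 ^+ i).[s] = (s ^+ 2) ^+ n - 1.
Proof.
have /(congr1 (fun q => q.[s])) := esym (subrX1 ('X^2 : {poly R}) n).
by rewrite !hornerE.
Qed.

(** Obtained by differentiating the factorization of [X^(2(n+1)) - 1]. It turns the derivative of
    the velocity into the force. *)
Lemma geometric_poly_deriv (R : comNzRingType) (n : nat) (s : R) :
  (s ^+ 2 - 1) * ((\sum_(i < n.+1) 'X^2 ^+ i)^`()).[s]
    + 2 * s * (\sum_(i < n.+1) 'X^2 ^+ i).[s]
  = 2 * n.+1%:R * (s ^+ 2) ^+ n * s.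
Proof.
have /(congr1 (fun q => (q^`()).[s])) := esym (subrX1 ('X^2 : {poly R}) n.+1).
rewrite derivM !derivB !deriv_exp derivX -polyC1 derivC !subr0
  hornerMn !hornerE /= => E.
by apply: etrans (etrans E _); ring.
Qed.

Lemma is_derive_mull (R : realType) (A : R) (f : R -> R) (t df : R) :
  is_derive t (1 : R) f df -> is_derive t (1 : R) (fun s => A * f s) (A * df).
Proof. exact: is_deriveZ. Qed.

Lemma oscillator (R : realType) (n : nat) (a h : R) : 0 < a -> 0 < h ->
  exists (x y : R -> R) (T : R),
    [/\ 0 < T,
        forall t : R, is_derive t (1 : R) x (y t),
        forall t : R, is_derive t (1 : R) y
          (- (2 * a * n.+1%:R * (x t ^+ 2) ^+ n * x t)),
        periodic x T &
        forall t, 2^-1 * y t ^+ 2 + a * (x t ^+ 2) ^+ n.+1 = h].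
Proof.
move=> a0 h0.
have [A A0 AE] : exists2 A : R, 0 < A & A ^+ (2 * n.+1) = h / a.
  by apply: exists_rootn => //; exact: divr_gt0.
have {}AE : a * (A ^+ 2) ^+ n.+1 = h by rewrite -exprM AE mulrC divfK ?gt_eqF.
pose P : {poly R} := \sum_(i < n.+1) 'X^2 ^+ i.
(* With this constant, [Num.sqrt (c * P.[sin u])] is the field [sqrt (2 h P(sin u)) / A]. *)
have [c cE] : {c | c = 2 * h / A ^+ 2} by eexists.
have c0 : 0 < c by rewrite cE divr_gt0 ?exprn_gt0 ?mulr_gt0.
have cP0 u : 0 < c * P.[sin u].
  by rewrite mulr_gt0// (lt_le_trans ltr01)// geometric_poly_ge1.
pose g u : R := Num.sqrt (c * P.[sin u]).
have gE u : g u ^+ 2 = c * P.[sin u] by rewrite sqr_sqrtr// ltW.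
have g0 u : 0 < g u by rewrite sqrtr_gt0.
have dg (u : R) : is_derive u (1 : R) g
    ((2 * g u)^-1 * (c * (P^`().[sin u] * cos u))).
  apply: (@is_derive1_comp _ Num.sqrt (fun u => c * P.[sin u])).
    exact: is_derive1_sqrt.
have cg : continuous g.
  by move=> z; apply/differentiable_continuous/derivable1_diffP; case: (dg z).
have gp : periodic g (pi *+ 2) by move=> u; rewrite /g sinD2pi.
have [|phi [T [T0 dphi phiT]]] := periodic_autonomous_ode _ _ _ cg g0 _ gp.
  by rewrite mulrn_wgt0// pi_gt0.
exists (fun t => A * sin (phi t)), (fun t => A * (cos (phi t) * g (phi t))), T.
have AcE : A * c * A = 2 * h by rewrite cE; field; rewrite gt_eqF.
split => //.
- by move=> t; apply: is_derive_mull; exact: is_derive1_comp.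
- move=> t.
  have dcos : is_derive t (1 : R) (fun t => cos (phi t))
      (- sin (phi t) * g (phi t)) by exact: is_derive1_comp.
  have dgphi := is_derive1_comp (dg (phi t)) (dphi t).
  apply: (is_derive_eq (is_derive_mull _ A _ _ _ (is_deriveM dcos dgphi))).
  have E := geometric_poly_deriv _ n (sin (phi t)); rewrite -/P in E.
  (* The extra factor [A] lets the constants combine into [A * c * A = 2 * h]; then
     [h = a * A^(2(n+1))] restores the force. *)
  apply: (mulfI (lt0r_neq0 A0)).
  (* The factor [g (phi t)] from the chain rule cancels the denominator of the derivative of [g], so
     only [g ^+ 2] remains. *)
  transitivity (A * (A * (c * P^`().[sin (phi t)] * cos (phi t) ^+ 2 / 2
                          - sin (phi t) * g (phi t) ^+ 2))).
    by rewrite /GRing.scale /=; field; exact: lt0r_neq0.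
  rewrite cos2sin2 gE.
  transitivity (- (A * c * A) / 2 * ((sin (phi t) ^+ 2 - 1)
      * P^`().[sin (phi t)] + 2 * sin (phi t) * P.[sin (phi t)])).
    by field.
  by rewrite E AcE -AE !exprMn exprS; field.
- by move=> t; rewrite phiT sinD2pi.
(* With [s = sin (phi t)], the kinetic energy is [h (1 - s^2) P(s) = h (1 - s^(2(n+1)))] and the
   potential energy is [h s^(2(n+1))]. *)
- move=> t; have E := geometric_poly_horner _ n.+1 (sin (phi t)).
  rewrite -/P in E.
  have -> : 2^-1 * (A * (cos (phi t) * g (phi t))) ^+ 2
      = - (A * c * A) / 2 * ((sin (phi t) ^+ 2 - 1) * P.[sin (phi t)]).
    transitivity (2^-1 * (A ^+ 2 * (cos (phi t) ^+ 2 * g (phi t) ^+ 2))).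
      by field.
    by rewrite cos2sin2 gE; field.
  have -> : (A * sin (phi t)) ^+ 2 = A ^+ 2 * sin (phi t) ^+ 2 by ring.
  by rewrite (exprMn n.+1 (A ^+ 2)) [a * _]mulrA AE E AcE; field.
Qed.

(** * The Euclidean norm and the gradient of the potential *)

Lemma sqr_enorm (R : realType) (d : nat) (q : 'rV[R]_d) :
  enorm q ^+ 2 = \sum_(i < d) q 0 i ^+ 2.
Proof. by rewrite sqr_sqrtr// sumr_ge0// => i _; exact: sqr_ge0. Qed.

Lemma sqr_enormZ (R : realType) (d : nat) (c : R) (q : 'rV[R]_d) :
  enorm (c *: q) ^+ 2 = c ^+ 2 * enorm q ^+ 2.
Proof.
by rewrite !sqr_enorm mulr_sumr; apply: eq_bigr => i _; rewrite mxE exprMn.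
Qed.

Lemma sqr_enorm_delta (R : realType) (d : nat) (i : 'I_d) :
  enorm (delta_mx 0 i : 'rV[R]_d) ^+ 2 = 1.
Proof.
rewrite sqr_enorm (bigD1 i)//= big1 => [|j ji]; rewrite mxE eqxx.
  by rewrite eqxx expr1n addr0.
by rewrite (negPf ji) expr0n.
Qed.

Lemma sqr_enorm_shift (R : realType) (d : nat) (q : 'rV[R]_d) (i : 'I_d)
    (s : R) :
  enorm (s *: delta_mx 0 i + q) ^+ 2 = enorm q ^+ 2 + 2 * q 0 i * s + s ^+ 2.
Proof.
rewrite !sqr_enorm (bigD1 i)//= [in RHS](bigD1 i)//= !mxE !eqxx.
rewrite (eq_bigr (fun j => q 0 j ^+ 2)) => [|j ji]; last first.
  by rewrite !mxE eqxx (negPf ji) mulr0 add0r.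
by rewrite /=; ring.
Qed.

(** Along a coordinate line, [V] is a polynomial in the parameter, because only the squared norm
    occurs. Each partial derivative is thus a polynomial derivative at [0], and the origin needs no
    separate treatment. *)
Lemma gradient_enorm_pow (R : realType) (d n : nat) (a : R)
    (V : 'rV[R]_d -> R) (q : 'rV[R]_d) :
  (forall q, V q = a * enorm q ^+ (2 * n.+1)) ->
  gradient V q = (2 * a * n.+1%:R * (enorm q ^+ 2) ^+ n) *: q.
Proof.
move=> VE; apply/rowP => i; rewrite !mxE.
pose p : {poly R} :=
  ((enorm q ^+ 2)%:P + (2 * q 0 i)%:P * 'X + 'X^2) ^+ n.+1.
have -> : 'D_(delta_mx 0 i) V q = 'D_1 (fun s => a * p.[s]) 0.
  have Ep s : V (s *: delta_mx 0 i + q) = a * p.[s].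
    by rewrite VE exprM sqr_enorm_shift !hornerE.
  have Ep0 : V q = a * p.[0] by rewrite -Ep scale0r add0r.
  rewrite /derive; under eq_fun do rewrite /= Ep Ep0.
  by under [in RHS]eq_fun do rewrite /= addr0 [_%:A]mulr1.
have [_ ->] := is_derive_mull _ a (horner p) (0 : R) _ (is_derive_poly p 0).
rewrite deriv_exp !derivD derivM derivXn !derivC derivX hornerMn !hornerE /=.
by rewrite !expr1 expr0n !addr0 -mulr_natr; ring.
Qed.

Theorem corollary1p5 (R : realType) (d k : nat) (hd : (1 <= d)%N)
    (hk : (1 <= k)%N) (a : R) (ha : 0 < a) (V : 'rV[R]_d -> R)
    (hV : forall q : 'rV[R]_d, V q = a * enorm q ^+ (2 * k)) (h : R)
    (hh : 0 < h) :
  exists (T : R) (q : R -> 'rV[R]_d),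
    [/\ 0 < T,
        C2 q,
        periodic q T,
        ~ (exists c : 'rV[R]_d, forall t : R, q t = c) &
        forall t : R,
          q^`(2)%classic t + gradient V (q t) = 0 /\
          2^-1 * enorm (q^`()%classic t) ^+ 2 + V (q t) = h].
Proof.
case: k hk hV => // n _ hV.
have [x [y [T [T0 dx dy xT energy]]]] := oscillator _ n _ _ ha hh.
(* A unit vector exists because [d >= 1]. *)
have [e e1] : exists e : 'rV[R]_d, enorm e ^+ 2 = 1.
  by exists (delta_mx 0 (Ordinal hd)); exact: sqr_enorm_delta.
pose force t := 2 * a * n.+1%:R * (x t ^+ 2) ^+ n * x t.
exists T, (fun t => x t *: e).
have dq t := is_derive_scalel _ _ e _ _ _ (dx t).
have dp t := is_derive_scalel _ _ e _ _ _ (dy t).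
have q1 : (fun t => x t *: e)^`()%classic = fun t => y t *: e.
  by apply/funext => t; rewrite derive1E; case: (dq t).
have p1 : (fun t => y t *: e)^`()%classic = fun t => - force t *: e.
  by apply/funext => t; rewrite derive1E; case: (dp t).
have q2 : (fun t => x t *: e)^`(2)%classic = fun t => - force t *: e.
  by rewrite derive1nS derive1n1 q1 p1.
have xcont : continuous x.
  by move=> t; apply/differentiable_continuous/derivable1_diffP; case: (dx t).
split => //.
- split=> [t|t|].
  + by case: (dq t).
  + by rewrite q1; case: (dp t).
  + rewrite q2 => t; apply: cvgZr_tmp; apply: cvgN.
    (* The force is a polynomial in [x t], hence continuous in [t]. *)
    pose p : {poly R} := (2 * a * n.+1%:R) *: (('X^2) ^+ n * 'X).
    have -> : force = horner p \o x.
      by apply/funext => s; rewrite /force /= !hornerE.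
    exact: (continuous_comp (xcont t) (@continuous_horner _ p _)).
- by move=> t; rewrite xT.
(* A constant solution has zero velocity and zero acceleration, so [y 0 = 0] and [x 0 = 0]. The
   energy would then be [0], against [0 < h]. *)
- move=> [c qc].
  have y0 t : y t *: e = 0.
    by have := congr1 (fun f => f t) q1; rewrite (funext qc) derive1_cst.
  have f0 t : force t *: e = 0.
    have := congr1 (fun f => f t) p1.
    rewrite (funext y0) derive1_cst scaleNr => /esym/eqP.
    by rewrite oppr_eq0 => /eqP.
  have coef0 c' : c' *: e = 0 -> c' = 0.
    move=> /(congr1 (fun v => enorm v ^+ 2)); rewrite sqr_enormZ e1 mulr1.
    rewrite -[0 in RHS](scale0r 0) sqr_enormZ expr0n mul0r => /eqP.
    by rewrite sqrf_eq0 => /eqP.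
  have := energy 0; rewrite (coef0 _ (y0 0)).
  have x0 : x 0 = 0.
    apply/eqP; move: (f0 0) => /coef0/eqP.
    rewrite /force !mulf_eq0 !pnatr_eq0 (gt_eqF ha)/= !expf_eq0/=.
    by case: (x 0 == 0); rewrite ?andbF.
  rewrite x0 !expr0n/= !mulr0 addr0 => h0.
  by move: hh; rewrite -h0 ltxx.
- move=> t; split.
    (* Since [e] is a unit vector, the squared norm of [x t *: e] is [x t ^+ 2], and the gradient
       becomes [force t *: e]. *)
    rewrite q2 (gradient_enorm_pow _ _ n a)// sqr_enormZ e1 mulr1 scalerA.
    by rewrite -scalerDl addNr scale0r.
  by rewrite q1 hV exprM !sqr_enormZ e1 !mulr1.
Qed.
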